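(* Let $X$ be a set of program states, $G \subseteq X$ a loop guard and $T \subseteq X \times X$ a transition relation that is deterministic, i.e. $\forall x .\ \exists x' .\ T(x,x') \wedge \forall x'' .\ (T(x,x'') \rightarrow x'' = x')$. Then the formula [ONT] $$\exists N \subseteq X, \exists x_0 \in X .\ \forall x .\ \exists x' .\ N(x_0) \wedge \big(N(x) \rightarrow G(x)\big) \wedge \big(N(x) \rightarrow T(x,x') \wedge N(x')\big)$$ is satisfiable if and only if the formula [CNT] $$\exists N \subseteq X, \exists x_0 \in X .\ \forall x, x' .\ N(x_0) \wedge \big(N(x) \rightarrow G(x)\big) \wedge \big(N(x) \wedge T(x,x') \rightarrow N(x')\big)$$ is satisfiable.
   Context: $G(x)$ means $x \in G$, $N(x)$ means $x\in N$, and $T(x,x')$ means $(x,x')\in T$. Quantifiers over $x,x',x''$ range over $X$. A witness $N$ of [CNT] is called a closed recurrence set. *)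

(* Defs.v *)
(* Stdlib world: subsets of a type [X] are predicates [X -> Prop], and binary
   relations on [X] are Stdlib's [relation X] (i.e. [X -> X -> Prop]). *)
From Stdlib Require Export Relation_Definitions.

(* "Deterministic" includes totality: every state has exactly one successor. *)
Definition deterministic (X : Type) (T : relation X) : Prop :=
  forall x : X, exists x' : X, T x x' /\ forall x'' : X, T x x'' -> x'' = x'.

(* In [ONT] and [CNT] the guard and the transition relation are fixed, so the
   formula's only unknowns are the quantified [N] and [x0], and its
   satisfiability is the truth of the sentence. *)
Definition ONT (X : Type) (G : X -> Prop) (T : relation X) : Prop :=
  exists (N : X -> Prop) (x0 : X), forall x : X, exists x' : X,
    N x0 /\ (N x -> G x) /\ (N x -> T x x' /\ N x').

Definition CNT (X : Type) (G : X -> Prop) (T : relation X) : Prop :=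
  exists (N : X -> Prop) (x0 : X), forall x x' : X,
    N x0 /\ (N x -> G x) /\ (N x /\ T x x' -> N x').

(* Main.v *)
Require Import Defs.

(** The same [N] and [x0] serve both formulas: when each state has exactly one successor, having
    some successor in [N] and having all successors in [N] coincide. *)

Theorem theorem4 (X : Type) (G : X -> Prop) (T : relation X)
  (hT : deterministic X T) : ONT X G T <-> CNT X G T.
Proof.
  split; intros (N & x0 & H); exists N, x0.
  - intros x x'.
    destruct (H x) as (y & H0 & HG & HN).
    repeat split; auto.
    intros [Nx Txx'].
    destruct (HN Nx) as [Txy Ny].
    destruct (hT x) as (z & _ & uniq).
    (* Both [x'] and [y] equal the unique successor [z]. *)
    rewrite (uniq x' Txx'), <- (uniq y Txy); exact Ny.
  - intros x.
    destruct (hT x) as (z & Txz & _).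
    (* A witness is due even for [x] outside [N]; totality of [T] supplies it. *)
    exists z.
    destruct (H x z) as (H0 & HG & HN).
    repeat split; auto.
Qed.
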